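(* Let $p_1,\dots,p_n$ be distinct primes and $N=p_1^{\alpha_1}\cdots p_n^{\alpha_n}$ with $\alpha_1\ge \alpha_2\ge\cdots\ge \alpha_u>\alpha_{u+1}=\cdots =\alpha_n\ge 2$ (where $u=0$ if $\alpha_1=\cdots=\alpha_n$). For a set $\mathcal D$ of positive divisors of $N$, the following statements are equivalent: (a) $\mathcal D$ is a maximal $N$-set with the minimum size; (b) $\mathcal D$ is a maximal $N$-set with $d(\mathcal D)=\{p_v\}$ for some $v$ with $u+1\le v\le n$; (c) $\mathcal D=\{d : d\mid N,\ p_v\mid d\}$ for some $v$ with $u+1\le v\le n$.
   Context: A set $\mathcal D$ of positive divisors of $N$ is an $N$-set if no two elements of $\mathcal D$ are coprime. An $N$-set is maximal if no additional positive divisor of $N$ can be included in it while keeping the $N$-set property. ''Maximal $N$-set with the minimum size'' means a maximal $N$-set whose cardinality is the minimum of the cardinalities of all maximal $N$-sets (this minimum is known to equal $\alpha_n\prod_{i=1}^{n-1}(\alpha_i+1)$). For a set $\mathcal D$ of positive divisors of $N$, $d(\mathcal D)$ denotes the set of divisible minimal elements of $\mathcal D$, i.e. those $d\in\mathcal D$ that are not divisible by any other element of $\mathcal D$. *)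

(* Defs.v *)
From mathcomp Require Import all_boot finmap.

Set Implicit Arguments.
Unset Strict Implicit.
Unset Printing Implicit Defensive.

Local Open Scope fset_scope.

Definition divisor_set (N : nat) (D : {fset nat}) : Prop :=
  forall d, d \in D -> d \in divisors N.

(* [a] and [b] are not required to be distinct: since [coprime 1 1], this says
   in particular that 1 never belongs to an N-set. With distinctness required,
   [fset 1] would be a maximal N-set of size 1. *)
Definition Nset (N : nat) (D : {fset nat}) : Prop :=
  divisor_set N D /\ forall a b, a \in D -> b \in D -> ~~ coprime a b.

Definition maximal_Nset (N : nat) (D : {fset nat}) : Prop :=
  Nset N D /\
  forall d, d \in divisors N -> d \notin D -> ~ Nset N (d |` D).

Definition min_size_maximal_Nset (N : nat) (D : {fset nat}) : Prop :=
  maximal_Nset N D /\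
  forall E : {fset nat}, maximal_Nset N E -> #|` D| <= #|` E|.

Definition div_minimal (D : {fset nat}) : {fset nat} :=
  [fset d in D | ~~ has (fun e => (e != d) && (e %| d)) D].

(* Main.v *)
Require Import Defs.
From mathcomp Require Import all_boot finmap zify.

Set Implicit Arguments.
Unset Strict Implicit.
Unset Printing Implicit Defensive.

Local Open Scope fset_scope.

(** Writing a divisor of [N] by its exponents, shift all exponents cyclically,
    the [i]-th one modulo [alpha i + 1].  If [m] is the least [alpha i + 1],
    then among [m] consecutive shifts of a divisor no two miss a common prime,
    so that at most one of them lies outside a maximal N-set [D]: elements
    outside [D] are coprime to elements of [D], which pairwise meet.  Averaging
    over all divisors, at most a fraction [1/m] of them lies outside [D], and
    the star of a prime of least exponent attains this.  If [D] attains it, then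
    every divisor has a shift outside [D]; as [m >= 3], this means that whenever
    the primes are split in three parts, some element of [D] is supported on one
    of them.  Hence an element of [D] cannot be minimal unless it is prime, and
    [D] is the star of that prime. *)

(** * Residues and counting *)

Lemma modn_add_eq0_inj (M x s t : nat) :
  s < M -> t < M -> (x + s) %% M = 0 -> (x + t) %% M = 0 -> s = t.
Proof.
move=> sM tM xs xt; have : x + s == x + t %[mod M] by rewrite xs xt.
by rewrite eqn_modDl !modn_small // => /eqP.
Qed.

Lemma sum_pred_le1 (m : nat) (P : pred 'I_m) :
  (forall s t, P s -> P t -> s = t) -> \sum_(t < m) P t <= 1.
Proof.
move=> uniqP; case: (pickP P) => [s Ps | P0]; last by rewrite big1 // => t _; rewrite P0.
rewrite (bigD1 s) //= big1 ?addn0 ?leq_b1 // => t tNs.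
by apply/eqP; rewrite eqb0; apply: contra tNs => /uniqP-/(_ _ Ps)->.
Qed.

Lemma count_Nmem_divisors (N : nat) (D : {fset nat}) : divisor_set N D ->
  (count (fun d => d \notin D) (divisors N) + #|` D|)%N = size (divisors N).
Proof.
move=> divD; have <- : count (mem D) (divisors N) = #|` D|.
  rewrite -size_filter; apply: perm_size; apply: uniq_perm.
  - by rewrite filter_uniq ?divisors_uniq.
  - exact: fset_uniq.
  by move=> d; rewrite mem_filter; apply/andP/idP => [[]|dD] //; split=> //; apply: divD.
by rewrite addnC count_predC.
Qed.

(** The shift argument counts divisors outside a set, so sizes are compared through complements,
    which reverses the order. *)
Lemma leq_card_divisor_set (N : nat) (D E : {fset nat}) :
  divisor_set N D -> divisor_set N E ->
  (#|` D| <= #|` E|) =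
  (count (fun d => d \notin E) (divisors N) <= count (fun d => d \notin D) (divisors N)).
Proof.
move=> /count_Nmem_divisors sD /count_Nmem_divisors sE.
by rewrite -(leq_add2l (count (fun d => d \notin D) (divisors N))) sD -sE leq_add2r.
Qed.

(** * Divisors and their exponents at the primes [p i] *)

Section PrimeProduct.

Variables (n : nat) (p : 'I_n -> nat).
Hypothesis p_prime : forall i, prime (p i).
Hypothesis p_inj : injective p.

Definition expprod (f : 'I_n -> nat) : nat := \prod_(i < n) p i ^ f i.

Lemma expprod_gt0 f : 0 < expprod f.
Proof. by apply: prodn_gt0 => i; rewrite expn_gt0 prime_gt0. Qed.

Lemma logn_expprodE q f : logn q (expprod f) = \sum_(i < n) (q == p i) * f i.
Proof.
suff [] : 0 < expprod f /\ logn q (expprod f) = \sum_(i < n) (q == p i) * f i by [].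
rewrite /expprod; apply: (big_rec2 (fun a b => 0 < b /\ logn q b = a)) => [|i a b _ [b0 <-]].
  by rewrite logn1.
have pi0 : 0 < p i ^ f i by rewrite expn_gt0 prime_gt0.
by rewrite muln_gt0 pi0 b0 lognM // lognX logn_prime // mulnC.
Qed.

Lemma logn_expprod f i : logn (p i) (expprod f) = f i.
Proof.
rewrite logn_expprodE (bigD1 i) //= eqxx mul1n big1 ?addn0 // => j jNi.
by rewrite (inj_eq p_inj) eq_sym (negbTE jNi).
Qed.

Lemma prime_dvd_expprod q f : prime q -> q %| expprod f -> exists i, q = p i.
Proof.
move=> q_pr; rewrite Euclid_dvd_prod // big_orE => /existsP[i /=].
by rewrite Euclid_dvdX // dvdn_prime2 // => /andP[/eqP-> _]; exists i.
Qed.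

Lemma prime_dvd_logn i d : 0 < d -> (p i %| d) = (0 < logn (p i) d).
Proof. by move=> d0; rewrite logn_gt0 mem_primes p_prime d0. Qed.

Lemma dvd_expprod f g : (forall i, f i <= g i) -> expprod f %| expprod g.
Proof.
move=> le_fg; apply: (big_rec2 (fun a b => a %| b)) => // i a b _ ab.
by apply: dvdn_mul; rewrite ?dvdn_exp2l.
Qed.

Variable alpha : 'I_n -> nat.
Let N := expprod alpha.

Lemma dvdN_gt0 d : d %| N -> 0 < d.
Proof. by apply: dvdn_gt0; apply: expprod_gt0. Qed.

Lemma mem_divisorsN d : (d \in divisors N) = (d %| N).
Proof. by rewrite dvdn_divisors // expprod_gt0. Qed.

Lemma logn_le_alpha i d : d %| N -> logn (p i) d <= alpha i.
Proof. by move=> /(dvdn_leq_log (p i) (expprod_gt0 _)); rewrite logn_expprod. Qed.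

Lemma expprod_logn d : d %| N -> expprod (fun i => logn (p i) d) = d.
Proof.
move=> dN; have d0 := dvdN_gt0 dN.
apply: eqn_from_log => // [|q]; first exact: expprod_gt0.
case: (boolP [exists i, q == p i]) => [/existsP[i /eqP->]|].
  by rewrite logn_expprod.
rewrite negb_exists => /forallP qNp.
rewrite logn_expprodE big1 => [|i _]; last by rewrite (negbTE (qNp i)).
apply/esym/eqP; rewrite -leqn0.
apply: leq_trans (dvdn_leq_log q (expprod_gt0 _) dN) _.
by rewrite logn_expprodE big1 // => i _; rewrite (negbTE (qNp i)).
Qed.

Lemma ncoprimeP a b : a %| N -> ~~ coprime a b -> exists i, p i %| a /\ p i %| b.
Proof.
move=> aN nco; have g1 : gcdn a b != 1 by [].
have q_pr : prime (pdiv (gcdn a b)).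
  by apply: pdiv_prime; have := dvdN_gt0 aN; case: gcdn (gcdn_gt0 a b) g1 => [|[]]; lia.
have := pdiv_dvd (gcdn a b); rewrite dvdn_gcd => /andP[qa qb].
by have [i qi] := prime_dvd_expprod q_pr (dvdn_trans qa aN); exists i; rewrite -qi.
Qed.

Lemma ncoprime_of_dvd i a b : p i %| a -> p i %| b -> ~~ coprime a b.
Proof.
move=> pa pb; rewrite /coprime; apply/eqP => g1.
have : p i %| gcdn a b by rewrite dvdn_gcd pa.
by rewrite g1 dvdn1 => /eqP p1; have := p_prime i; rewrite p1.
Qed.

(** * Cyclic shifts of exponents *)

Definition shift (t d : nat) : nat :=
  expprod (fun i => (logn (p i) d + t) %% (alpha i).+1).

Lemma shift_dvd t d : shift t d %| N.
Proof. by apply: dvd_expprod => i; rewrite -ltnS ltn_mod. Qed.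

Lemma prime_dvd_shift i t d :
  (p i %| shift t d) = ((logn (p i) d + t) %% (alpha i).+1 != 0).
Proof. by rewrite prime_dvd_logn ?expprod_gt0 // logn_expprod lt0n. Qed.

Lemma shift_inj t : {in divisors N &, injective (shift t)}.
Proof.
move=> a b; rewrite !mem_divisorsN => aN bN eq_ab.
rewrite -(expprod_logn aN) -(expprod_logn bN); apply: eq_bigr => i _; congr (_ ^ _).
have /(congr1 (logn (p i))) := eq_ab; rewrite !logn_expprod => /eqP.
by rewrite eqn_modDr !modn_small ?ltnS ?logn_le_alpha // => /eqP.
Qed.

Lemma perm_shift_divisors t : perm_eq (map (shift t) (divisors N)) (divisors N).
Proof.
have u : uniq (map (shift t) (divisors N)).
  by rewrite map_inj_in_uniq ?divisors_uniq //; apply: shift_inj.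
apply: uniq_perm; rewrite ?divisors_uniq //.
have sub : {subset map (shift t) (divisors N) <= divisors N}.
  by move=> _ /mapP[d _ ->]; rewrite mem_divisorsN shift_dvd.
by have [] := uniq_min_size u sub; rewrite ?size_map.
Qed.

(** Double counting: each shift permutes the divisors, so every [t] contributes the same count. *)
Lemma sum_shift (m : nat) (P : pred nat) :
  \sum_(d <- divisors N) \sum_(t < m) P (shift t d) = m * count P (divisors N).
Proof.
rewrite exchange_big /=.
rewrite (eq_bigr (fun=> count P (divisors N))) ?sum_nat_const ?card_ord // => t _.
rewrite -(seq.permP (perm_shift_divisors t)) -sum1_count big_map [RHS]big_mkcond.
by apply: eq_bigr => d _; case: (P _).
Qed.

(** * Stars of primes *)

Definition star (v : 'I_n) : {fset nat} := [fset d in divisors N | p v %| d].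

Lemma in_star v d : (d \in star v) = (d %| N) && (p v %| d).
Proof. by rewrite !inE /= mem_divisorsN. Qed.

Lemma prime_dvdN v : 0 < alpha v -> p v %| N.
Proof. by move=> av; rewrite prime_dvd_logn ?expprod_gt0 // logn_expprod. Qed.

Lemma star_maximal v : 0 < alpha v -> maximal_Nset N (star v).
Proof.
move=> /prime_dvdN pN; split; first split.
- by move=> d; rewrite in_star mem_divisorsN => /andP[].
- by move=> a b; rewrite !in_star => /andP[_ pa] /andP[_ pb]; apply: ncoprime_of_dvd pa pb.
move=> d; rewrite mem_divisorsN => dN; rewrite in_star dN /= => pNd [_].
have pS : p v \in d |` star v by rewrite in_fset1U in_star pN dvdnn orbT.
by move=> /(_ _ _ pS (fset1U1 _ _))/negP; rewrite prime_coprime.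
Qed.

(** As [t] runs over a full period, the shifted exponent at [p v] vanishes exactly once. *)
Lemma count_Nmem_star v :
  (alpha v).+1 * count (fun d => d \notin star v) (divisors N) = size (divisors N).
Proof.
rewrite -sum_shift -sum1_size; apply: eq_big_seq => d; rewrite mem_divisorsN => dN.
set x := logn (p v) d; have xM : x < (alpha v).+1 by rewrite ltnS logn_le_alpha.
have NstarE t : (shift t d \notin star v) = ((x + t) %% (alpha v).+1 == 0).
  by rewrite in_star shift_dvd prime_dvd_shift negbK.
apply/eqP; rewrite eqn_leq sum_pred_le1 => [|s t]; last first.
  by rewrite !NstarE => /eqP xs /eqP xt; apply: val_inj; apply: modn_add_eq0_inj xs xt.
(* The modulus matters only for [x = 0], where the difference is the full period. *)
have t0 : ((alpha v).+1 - x) %% (alpha v).+1 < (alpha v).+1 by rewrite ltn_mod.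
by rewrite (bigD1 (Ordinal t0)) //= NstarE modnDmr (subnKC (ltnW xM)) modnn eqxx.
Qed.

(** * Maximal N-sets *)

Section MaximalNset.

Variables (D : {fset nat}) (v : 'I_n).
Hypotheses (maxD : maximal_Nset N D) (alpha_v : 0 < alpha v).

Lemma maximal_dvdN d : d \in D -> d %| N.
Proof. by case: maxD => -[divD _] _ /divD; rewrite mem_divisorsN. Qed.

Lemma maximal_ncoprime a b : a \in D -> b \in D -> ~~ coprime a b.
Proof. by case: maxD => -[_ +] _; apply. Qed.

Lemma maximal_nonempty : exists d, d \in D.
Proof.
have [D0|[d dD]] := fset_0Vmem D; last by exists d.
have [_ /(_ (p v))] := maxD; rewrite mem_divisorsN D0 in_fset0 => -[] //.
  exact: prime_dvdN.
split=> [d|a b]; rewrite !in_fset1U !in_fset0 !orbF.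
  by move=> /eqP->; rewrite mem_divisorsN prime_dvdN.
by move=> /eqP-> /eqP->; apply: (@ncoprime_of_dvd v).
Qed.

Lemma Nmem_maximal d : d %| N -> d \notin D -> exists2 e, e \in D & coprime d e.
Proof.
move=> dN dD; case: (boolP (has (coprime d) (enum_fset D))) => [/hasP[e]|/hasPn nco].
  by exists e.
(* [d] must also meet itself, so [d = 1] is excluded: 1 is coprime to every element of the nonempty
   [D]. *)
have dd : ~~ coprime d d.
  have [e /nco] := maximal_nonempty; apply: contra.
  by rewrite /coprime gcdnn => /eqP->; rewrite gcd1n.
case: maxD => -[divD coD] /(_ d); rewrite mem_divisorsN => -[] //; split.
  by move=> a /fset1UP[->|/divD//]; rewrite mem_divisorsN.
move=> a b /fset1UP[->|aD] /fset1UP[->|bD] //; first exact: nco.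
  by rewrite coprime_sym nco.
exact: coD.
Qed.

(** An element of [D] coprime to [d] would still share a prime with [e], and that prime divides
    [d]. *)
Lemma maximal_supp_closed d e :
  e \in D -> d %| N -> (forall i, p i %| e -> p i %| d) -> d \in D.
Proof.
move=> eD dN ed; apply/idPn => /(Nmem_maximal dN)[e' e'D].
have [i [pe pe']] := ncoprimeP (maximal_dvdN eD) (maximal_ncoprime eD e'D).
by apply/negP; apply: ncoprime_of_dvd (ed i pe) pe'.
Qed.

Lemma maximal_eq_star w : p w \in D -> D = star w.
Proof.
move=> pD; apply/fsetP => d; rewrite in_star; apply/idP/andP => [dD|[dN pd]].
  by rewrite maximal_dvdN // -[_ %| _]negbK -prime_coprime // maximal_ncoprime.
apply: maximal_supp_closed pD dN _ => i.
by rewrite dvdn_prime2 // => /eqP->.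
Qed.

(** Two shifts outside [D] are coprime to some [a] and [b] in [D]. A common prime [p i] of [a] and
    [b] has exponent 0 in both shifts, and [s], [t] are below its period. *)
Lemma shift_Nmem_le1 m d : (forall i, m <= (alpha i).+1) ->
  \sum_(t < m) (shift t d \notin D) <= 1.
Proof.
move=> m_le; apply: sum_pred_le1 => s t.
move=> /(Nmem_maximal (shift_dvd _ _))[a aD sa] /(Nmem_maximal (shift_dvd _ _))[b bD tb].
have [i [pa pb]] := ncoprimeP (maximal_dvdN aD) (maximal_ncoprime aD bD).
have Ndvd x c : p i %| c -> coprime x c -> ~~ (p i %| x).
  by move=> pc; apply: contraL => /ncoprime_of_dvd-/(_ _ pc).
apply/val_inj/(@modn_add_eq0_inj (alpha i).+1 (logn (p i) d)).
- exact: leq_trans (ltn_ord _) (m_le i).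
- exact: leq_trans (ltn_ord _) (m_le i).
- by have := Ndvd _ _ pa sa; rewrite prime_dvd_shift negbK => /eqP.
- by have := Ndvd _ _ pb tb; rewrite prime_dvd_shift negbK => /eqP.
Qed.

Lemma count_Nmem_maximal m : (forall i, m <= (alpha i).+1) ->
  m * count (fun d => d \notin D) (divisors N) <= size (divisors N).
Proof.
move=> m_le; rewrite -sum_shift -sum1_size.
by apply: leq_sum => d _; apply: shift_Nmem_le1.
Qed.

(** Equality in the average makes the deficits [1 - F x] sum to 0; as [F x <= 1], none is truncated,
    so every [F x] is 1. *)
Lemma shift_Nmem_ex m d : (forall i, m <= (alpha i).+1) ->
  m * count (fun d => d \notin D) (divisors N) = size (divisors N) ->
  d %| N -> exists2 t, t < m & shift t d \notin D.
Proof.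
move=> m_le tight dN; pose F x := \sum_(t < m) (shift t x \notin D).
have sumF : \sum_(x <- divisors N) (1 - F x) = 0.
  rewrite sumnB => [|x _]; last exact: shift_Nmem_le1.
  by rewrite sum1_size /F (sum_shift m (fun x => x \notin D)) tight subnn.
have /allP/(_ d) : all (fun x => true ==> (1 - F x == 0)) (divisors N).
  by rewrite -sum_nat_seq_eq0 sumF.
rewrite mem_divisorsN subn_eq0 => /(_ dN) /=.
case: (pickP (fun t : 'I_m => shift t d \notin D)) => [t tD _|D0]; first by exists t.
by rewrite /F big1 // => t _; rewrite D0.
Qed.

(** With [d] the least element of [D] and [p w] a prime of it, the primes are split into [p w], the
    other primes of [d], and the rest. *)
Lemma tight_maximal_star m : 2 < m -> (forall i, m <= (alpha i).+1) ->
  m * count (fun d => d \notin D) (divisors N) = size (divisors N) ->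
  exists w, D = star w.
Proof.
move=> m_gt2 m_le tight.
have [d dD d_min] : exists2 d, d \in D & forall e, e \in D -> d <= e.
  have ex : exists d, d \in D by exact: maximal_nonempty.
  by case: (ex_minnP ex) => d dD d_min; exists d.
have dN := maximal_dvdN dD; have d_gt0 := dvdN_gt0 dN.
have [w [pd _]] := ncoprimeP dN (maximal_ncoprime dD dD).
exists w; apply: maximal_eq_star; apply/idPn => pND.
have pN := dvdn_trans pd dN.
(* [d] stripped of [p w]: a smaller divisor, hence outside [D]. *)
pose e' := expprod (fun i => if i == w then 0 else logn (p i) d).
have e'd : e' %| d.
  by rewrite -[d in _ %| d]expprod_logn //; apply: dvd_expprod => i; case: eqP.
have e'ND : e' \notin D.
  apply/negP => /d_min de'; have : p w %| e'.
    by have /eqP-> : e' == d by rewrite eqn_leq de' dvdn_leq.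
  by rewrite prime_dvd_logn ?expprod_gt0 // logn_expprod eqxx.
have p_e' i : (p i %| e') = (i != w) && (p i %| d).
  by rewrite !prime_dvd_logn ?expprod_gt0 // logn_expprod; case: eqP.
(* Modulo [alpha i + 1], [x] has exponent 0 at [p w], -1 at the other primes of
   [d] and -2 elsewhere: its shifts by 0, 1, 2 miss exactly these three sets of
   primes, and its further shifts by less than [m] miss no prime. *)
pose x := expprod (fun i => if i == w then 0
                            else if p i %| d then alpha i else (alpha i).-1).
have xN : x %| N by apply: dvd_expprod => i; do 2?case: ifP => // _; apply: leq_pred.
have [t t_lt /(Nmem_maximal (shift_dvd _ _))[e eD coe]] := shift_Nmem_ex m_le tight xN.
have supp_e i : p i %| e ->
  ((if i == w then 0 else if p i %| d then alpha i else (alpha i).-1) + t)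
    %% (alpha i).+1 = 0.
  move=> pe; have : ~~ (p i %| shift t x).
    by apply: contraL coe => /ncoprime_of_dvd-/(_ _ pe).
  by rewrite prime_dvd_shift logn_expprod negbK => /eqP.
have eN := maximal_dvdN eD.
have supp_eq i : p i %| e -> t = if i == w then 0 else if p i %| d then 1 else 2.
  move=> /supp_e xt; have a_gt1 : 1 < alpha i by rewrite -ltnS (leq_trans m_gt2).
  refine (modn_add_eq0_inj (leq_trans t_lt (m_le i)) _ xt _).
    by case: ifP => // _; case: ifP => // _; apply: ltnW.
  case: ifP => _; first by rewrite mod0n.
  case: ifP => _; first by rewrite addn1 modnn.
  by rewrite addn2 prednK ?modnn // ltnW.
(* The primes of [e] lie in a single part. The first would put [p w] in [D], the second [e'], and
   the third would make [e] coprime to [d]. *)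
case: t => [|[|t]] in t_lt coe supp_e supp_eq *.
- move/negP: pND; apply; apply: maximal_supp_closed eD pN _ => i /supp_eq.
  by case: eqP => [->|_] //; case: ifP.
- move/negP: e'ND; apply; apply: maximal_supp_closed eD (dvdn_trans e'd dN) _ => i.
  by rewrite p_e' => /supp_eq; case: eqP => // _; case: ifP.
- have [i [pe pd']] := ncoprimeP eN (maximal_ncoprime eD dD).
  by have := supp_eq i pe; rewrite pd'; case: eqP.
Qed.

End MaximalNset.

Lemma div_minimal_star v : 0 < alpha v -> div_minimal (star v) = [fset p v].
Proof.
move=> /prime_dvdN pN; have pS : p v \in star v by rewrite in_star pN dvdnn.
apply/fsetP => d; rewrite !inE /=.
apply/andP/eqP => [[]|->].
  rewrite mem_divisorsN => /andP[_ pd] /hasPn/(_ _ pS).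
  by rewrite pd andbT negbK => /eqP.
split; first by rewrite mem_divisorsN pN dvdnn.
apply/hasPn => e; rewrite in_star => /andP[_ pe].
by apply/negP => /andP[/eqP eNp ep]; apply/eNp/eqP; rewrite eqn_dvd ep.
Qed.

End PrimeProduct.

(* Indices are 0-based: p_{i+1} and alpha_{i+1} are [p i] and [alpha i], so that
   "u + 1 <= v <= n" reads [u <= v] for [v : 'I_n]. *)
Theorem theorem1 (n : nat) (p alpha : 'I_n -> nat) (u N : nat)
    (p_prime : forall i : 'I_n, prime (p i))
    (p_distinct : injective p)
    (N_def : N = \prod_(i < n) p i ^ alpha i)
    (u_lt_n : u < n)
    (alpha_noninc : forall i j : 'I_n, i <= j -> alpha j <= alpha i)
    (alpha_drop : forall i j : 'I_n,
       i.+1 = u -> nat_of_ord j = u -> alpha j < alpha i)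
    (alpha_const : forall i j : 'I_n, u <= i -> u <= j -> alpha i = alpha j)
    (alpha_ge2 : forall i : 'I_n, u <= i -> 2 <= alpha i)
    (D : {fset nat}) (D_divisors : divisor_set N D) :
  (min_size_maximal_Nset N D <->
     (maximal_Nset N D /\
      exists v : 'I_n, u <= v /\ div_minimal D = [fset p v])) /\
  ((maximal_Nset N D /\
      exists v : 'I_n, u <= v /\ div_minimal D = [fset p v]) <->
     (exists v : 'I_n, u <= v /\
        D = [fset d in divisors N | p v %| d])).
Proof.
have NE : N = expprod p alpha by [].
rewrite NE in D_divisors *; pose M := expprod p alpha.
(* [w] starts the constant block, so [m] is the least period. *)
pose w := Ordinal u_lt_n; pose m := (alpha w).+1.
have m_gt2 : 2 < m by rewrite ltnS alpha_ge2.
have m_le i : m <= (alpha i).+1.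
  have [ui|/ltnW iu] := leqP u i; first by rewrite (alpha_const i w).
  by rewrite ltnS alpha_noninc.
have alpha_gt0 i : 0 < alpha i by have := m_le i; lia.
have mE (v : 'I_n) : u <= v -> (alpha v).+1 = m by move=> uv; rewrite /m (alpha_const v w).
have size_gt0 : 0 < size (divisors M).
  have : M \in divisors M by rewrite mem_divisorsN // dvdnn.
  by case: divisors.
have star_max v : maximal_Nset M (star p alpha v) by exact: star_maximal.
have bc : (maximal_Nset M D /\
      exists v : 'I_n, u <= v /\ div_minimal D = [fset p v]) <->
     (exists v : 'I_n, u <= v /\ D = star p alpha v).
  split=> [[maxD [v [uv minD]]]|[v [uv ->]]].
    exists v; split=> //; apply: (maximal_eq_star p_prime p_distinct maxD (alpha_gt0 w)).
    have : p v \in div_minimal D by rewrite minD inE.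
    by rewrite inE => /andP[].
  by split=> //; exists v; rewrite div_minimal_star.
split; last exact: bc.
apply: iff_trans (iff_sym bc); split=> [[maxD minD]|[v [uv ->]]].
  (* Averaging gives one inequality; the other holds because [D] is no larger than [star w], which
     attains the bound. *)
  have tight : m * count (fun d => d \notin D) (divisors M) = size (divisors M).
    apply/eqP; rewrite eqn_leq (count_Nmem_maximal p_prime p_distinct maxD (alpha_gt0 w)) //=.
    rewrite -[X in X <= _](count_Nmem_star p_prime p_distinct alpha w) leq_pmul2l //.
    rewrite -leq_card_divisor_set //; first exact: minD.
    by have [[]] := star_max w.
  have [v Dv] := tight_maximal_star p_prime p_distinct maxD (alpha_gt0 w)
    m_gt2 m_le tight.
  exists v; split=> //; move: tight.
  (* The same count multiplied by [m] and by [alpha v + 1] gives the number of divisors; it is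
     nonzero, so [alpha v = alpha w]. *)
  rewrite -(count_Nmem_star p_prime p_distinct alpha v) -Dv -/M => /eqP.
  rewrite eqn_pmul2r; last first.
    have := count_Nmem_star p_prime p_distinct alpha v.
    by rewrite -Dv -/M; case: count => //; rewrite muln0 => s0; rewrite -s0 in size_gt0.
  move=> /eqP mv; rewrite leqNgt; apply/negP => vu.
  (* If [v < u], the drop just before [u] gives [alpha v > alpha w]. *)
  have u1 : u.-1 < n by lia.
  have := alpha_drop (Ordinal u1) w; have := alpha_noninc v (Ordinal u1).
  by rewrite /=; move: mv; rewrite /m; lia.
split=> // E maxE.
rewrite (@leq_card_divisor_set M); [|by have [[]] := star_max v|by have [[]] := maxE].
rewrite -(leq_pmul2l (ltn0Sn (alpha v))) count_Nmem_star //.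
by apply: (count_Nmem_maximal p_prime p_distinct maxE (alpha_gt0 w)) => i; rewrite mE.
Qed.
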